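(* Let $\mathcal{H}$ be a complex Hilbert space, let $T,S\in\mathcal{B}(\mathcal{H})$, let $q\in(0,1]$, let $n$ be a positive integer, and let $\alpha=e^{\pi \mathrm{i}/(2n)}$ (an $n$-th root of the imaginary unit $\mathrm{i}$). Let $\mathbb{P}$ be the $n\times n$ tridiagonal operator matrix $$\mathbb{P}=\begin{bmatrix} T & \alpha^{n-2}S & O & \cdots & O\\ \mathrm{i}S & T & \alpha^{n-2}S & \cdots & \vdots\\ O & \mathrm{i}S & T & \ddots & O\\ \vdots & \vdots & \ddots & \ddots & \alpha^{n-2}S\\ O & O & \cdots & \mathrm{i}S & T\end{bmatrix}$$ acting on $\bigoplus_{j=1}^n\mathcal{H}$ (diagonal entries $T$, entries immediately above the diagonal $\alpha^{n-2}S$, entries immediately below the diagonal $\mathrm{i}S$, all other entries $O$). Then $$\max_{1\le k\le n} w_q\left(T+\left(2\alpha^{n-1}\cos\frac{k\pi}{n+1}\right)S\right)\le w_q(\mathbb{P})\le \frac{q+2\sqrt{1-q^2}}{q}\max_{1\le k\le n} w_q\left(T+\left(2\alpha^{n-1}\cos\frac{k\pi}{n+1}\right)S\right).$$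
   Context: $\mathcal{B}(\mathcal{K})$ denotes the bounded linear operators on a complex Hilbert space $\mathcal{K}$; $O$ is the zero operator. An $n\times n$ matrix $[S_{ij}]$ with entries in $\mathcal{B}(\mathcal{H})$ acts on $\bigoplus_{j=1}^n\mathcal{H}$ (with the direct-sum inner product) by $(x_1,\dots,x_n)\mapsto(\sum_j S_{1j}x_j,\dots,\sum_j S_{nj}x_j)$. For $A\in\mathcal{B}(\mathcal{K})$ and a scalar $q$ with $|q|\le 1$, the $q$-numerical range is $W_q(A)=\{\langle Ax,y\rangle: x,y\in\mathcal{K},\ \|x\|=\|y\|=1,\ \langle x,y\rangle=q\}$ and the $q$-numerical radius is $w_q(A)=\sup\{|z|: z\in W_q(A)\}$. In the degenerate case $\dim\mathcal{K}=1$, where $A$ is a scalar $c$ and $W_q(A)$ is empty for $0<q<1$, the convention is $w_q(A)=q|c|$. *)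

(* Defs.v *)
From HB Require Import structures.
From mathcomp Require Import all_boot all_order all_algebra.
From mathcomp Require Import sesquilinear complex.
From mathcomp Require Import boolp classical_sets functions reals.
From mathcomp Require Import topology normedtype sequences trigo.

Set Implicit Arguments.
Unset Strict Implicit.
Unset Printing Implicit Defensive.

Import Order.TTheory GRing.Theory Num.Theory Num.Def.
Import numFieldNormedType.Exports.

Local Open Scope classical_set_scope.
Local Open Scope ring_scope.
Local Open Scope complex_scope.

(* [inner] is linear in its first argument and conjugate-linear in the second *)
HB.mixin Record CompleteNormedModule_isHilbert (R : realType) H
    of CompleteNormedModule R[i] H := {
  inner : {dot H for @conjC R[i]};
  norm_inner : forall x : H, `|x| ^+ 2 = inner x x
}.

#[short(type="hilbertType")]
HB.structure Definition Hilbert (R : realType) :=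
  { H of CompleteNormedModule R[i] H & CompleteNormedModule_isHilbert R H }.

Notation "''[' x , y ]" := (inner x y)
  (format "''[' x ,  y ]") : ring_scope.

Section DotLmodule.
Variables (C : numClosedFieldType) (U : lmodType C) (f : {dot U for @conjC C}).

Lemma dot_CauchySchwarz (u v : U) :
  `|f u v| <= sqrtC (f u u) * sqrtC (f v v).
Proof.
have [->|v0] := eqVneq v 0; first by rewrite linear0r normr0 mulr_ge0 ?sqrtC_ge0.
have fv0 : 0 < f v v by rewrite dnorm_gt0.
rewrite -sqrtCM ?nnegrE// -(sqrCK (normr_ge0 _)) ler_sqrtC ?nnegrE ?mulr_ge0//.
have := dnorm_ge0 f (u - (f u v / f v v) *: v).
set c := f u v / f v v.
have fuc : f u (c *: v) = `|f u v| ^+ 2 / f v v.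
  by rewrite linearZr_LR/= rmorphM/= fmorphV/= (CrealP (gtr0_real fv0)) mulrAC
     -normCKC.
have cE : `|c| ^+ 2 * f v v = `|f u v| ^+ 2 / f v v.
  by rewrite normrM normfV (gtr0_norm fv0) exprMn -mulrA; congr (_ * _);
     rewrite expr2 -mulrA mulVf ?mulr1// gt_eqF.
have dR : `|f u v| ^+ 2 / f v v \is Num.real.
  by apply: ger0_real; apply: divr_ge0; rewrite ?exprn_ge0 ?(ltW fv0).
rewrite dnormB dnormZ cE fuc (CrealP dR) opprD addrA addrK subr_ge0.
by rewrite ler_pdivrMr.
Qed.

Lemma dot_triangle (u v : U) :
  sqrtC (f (u + v) (u + v)) <= sqrtC (f u u) + sqrtC (f v v).
Proof.
rewrite -ler_sqr ?nnegrE ?addr_ge0 ?sqrtC_ge0//.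
rewrite sqrrD !sqrtCK dnormD -[leRHS]addrAC lerD2l.
apply: (@le_trans _ _ (`|f u v| *+ 2)); last by rewrite lerMn2r dot_CauchySchwarz.
rewrite addrC -[X in X <= _](divfK (negbT (pnatr_eq0 C 2))) mulr_natr lerMn2r/=.
by rewrite [_ + f u v]addrC -ReE; have [+ _] := leif_Re_Creal (f u v).
Qed.
End DotLmodule.

Definition dsum (R : realType) (H : hilbertType R) (n : nat) :=
  {ffun 'I_n -> H}.

Section Dsum.
Variables (R : realType) (H : hilbertType R) (n : nat).
Local Notation V := (dsum H n).

HB.instance Definition _ := GRing.Lmodule.on V.

Definition dsum_inner (x y : V) : R[i] := \sum_i '[x i, y i].

Let dsum_bilinear :
  bilinear_for (GRing.Scale.Law.clone _ _ *%R _)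
    (GRing.Scale.Law.clone _ _ (@conjC R[i] \; *%R) _) dsum_inner.
Proof.
split=> [y a x x'|x a y y'] /=; rewrite /dsum_inner mulr_sumr -big_split/=.
  by apply: eq_bigr => i _; rewrite !ffunE linearPl.
by apply: eq_bigr => i _; rewrite !ffunE linearPr.
Qed.

HB.instance Definition _ :=
  bilinear_isBilinear.Build _ _ _ _ _ _ dsum_inner dsum_bilinear.

Let dsum_hermitian (x y : V) :
  dsum_inner x y = (-1) ^+ false * (dsum_inner y x)^*.
Proof.
rewrite expr0 mul1r rmorph_sum/=.
by apply: eq_bigr => i _; rewrite hermC expr0 mul1r.
Qed.

HB.instance Definition _ :=
  isHermitianSesquilinear.Build _ _ _ _ dsum_inner dsum_hermitian.

Let dsum_dot (x : V) : x != 0 -> 0 < dsum_inner x x.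
Proof.
move=> x0; rewrite lt_neqAle sumr_ge0 ?andbT => [|i _]; last exact: dnorm_ge0.
apply: contra x0; rewrite eq_sym psumr_eq0 => [/allP x0|i _]; last exact: dnorm_ge0.
apply/eqP/ffunP => i; rewrite ffunE; apply/eqP.
by have := x0 i (mem_index_enum i); rewrite /= dnorm_eq0.
Qed.

HB.instance Definition _ := isDotProduct.Build _ _ dsum_inner dsum_dot.

Let nrm (x : V) : R[i] := sqrtC (dsum_inner x x).

Let ler_nrmD (x y : V) : nrm (x + y) <= nrm x + nrm y.
Proof. exact: dot_triangle. Qed.

Let nrmZ (a : R[i]) (x : V) : nrm (a *: x) = `|a| * nrm x.
Proof. by rewrite /nrm dnormZ sqrtCM ?sqrCK ?nnegrE ?exprn_ge0 ?dnorm_ge0. Qed.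

Let nrm0_eq0 (x : V) : nrm x = 0 -> x = 0.
Proof. by move/eqP; rewrite sqrtC_eq0 dnorm_eq0 => /eqP. Qed.

HB.instance Definition _ :=
  Lmodule_isNormed.Build R[i] V ler_nrmD nrmZ nrm0_eq0.

Lemma dsum_normE (x : V) : `|x| = sqrtC (\sum_i `|x i| ^+ 2).
Proof.
transitivity (nrm x) => //; congr sqrtC.
by apply: eq_bigr => i _; rewrite norm_inner.
Qed.

Let sum_ge0 (x : V) (P : pred 'I_n) m : 0 <= \sum_(i | P i) `|x i| ^+ m.
Proof. by apply: sumr_ge0 => i _; rewrite exprn_ge0. Qed.

Lemma dsum_norm_ge (x : V) i : `|x i| <= `|x|.
Proof.
rewrite dsum_normE -[leLHS]sqrCK// ler_sqrtC ?nnegrE ?exprn_ge0//.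
by rewrite (bigD1 i)//= lerDl.
Qed.

Lemma dsum_norm_le (x : V) : `|x| <= \sum_i `|x i|.
Proof.
have s0 := sum_ge0 x xpredT 1.
rewrite dsum_normE -[leRHS]sqrCK// ler_sqrtC ?nnegrE ?exprn_ge0//.
rewrite [leRHS]expr2 mulr_suml; apply: ler_sum => i _.
rewrite expr2 ler_wpM2l// (bigD1 i)//= lerDl.
exact: (sum_ge0 x _ 1).
Qed.

Let dsum_complete (F : set_system V) : ProperFilter F -> cauchy F -> cvg F.
Proof.
move=> FF /cauchyP Fc; apply/cvg_ex.
have Fi i : cvg ((fun x : V => x i) @ F).
  have PF : ProperFilter ((fun x : V => x i) @ F) by exact: fmap_proper_filter.
  apply: (@cauchy_cvg H _ PF).
  apply: (@cauchy_exP R[i] H _ PF) => e e0.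
  have [x Fx] := Fc e e0.
  exists (x i).
  suff xF : ball x e `<=` [set y : V | ball (x i) e (y i)] by exact: filterS xF Fx.
  move=> y; rewrite -!ball_normE/= => xy; apply: le_lt_trans xy.
  by have := dsum_norm_ge (x - y) i; rewrite !ffunE.
exists [ffun i => lim ((fun x : V => x i) @ F)].
apply/cvgrPdist_le => e e0; near=> y.
apply: (le_trans (dsum_norm_le _)).
apply: (@le_trans _ _ (\sum_(i < n) e / n.+1%:R)); last first.
  rewrite sumr_const card_ord -[leLHS]mulr_natr -mulrA ler_piMr ?(ltW e0)//.
  by rewrite mulrC ler_pdivrMr ?ltr0n// mul1r ler_nat.
apply: ler_sum => i _; rewrite !ffunE; move: i; near: y.
apply: filter_forall => i; have /cvgrPdist_le := Fi i; apply.
by rewrite divr_gt0 ?ltr0n.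
Unshelve. all: by end_near. Qed.

HB.instance Definition _ := Uniform_isComplete.Build V dsum_complete.

Let dsum_norm_inner (x : V) : `|x| ^+ 2 = dsum_inner x x.
Proof. by rewrite -[`|x|]/(nrm x) sqrtCK. Qed.

HB.instance Definition _ :=
  CompleteNormedModule_isHilbert.Build R V dsum_norm_inner.

Lemma dsum_innerE (x y : V) : '[x, y] = \sum_i '[x i, y i].
Proof. by []. Qed.
End Dsum.

Section QNumericalRange.
Variables (R : realType) (K : hilbertType R).
Implicit Types (A : {linear K -> K}) (q : R[i]).

Definition bounded_op A := exists M : R[i], forall x, `|A x| <= M * `|x|.

Definition q_numrange q A : set R[i] :=
  [set z | exists x y : K,
    [/\ `|x| = 1, `|y| = 1, '[x, y] = q & z = '[A x, y]]].

Definition one_dim := exists2 e : K, e != 0 & forall x, exists c : R[i], x = c *: e.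

(* The modulus is taken as the real number [normc z], since [`|z|] lies in
   [R[i]]. In dimension one the [xget] picks the unique scalar by which [A]
   acts. The supremum of an empty set is [0], which matters only for the zero
   space and for values of [q] left out by the convention. *)
Definition q_numradius q A : R :=
  if `[< one_dim >] && (0 < q < 1) then
    Normc.normc q * Normc.normc (xget 0 [set c | forall x, A x = c *: x])
  else sup [set Normc.normc z | z in q_numrange q A].

End QNumericalRange.

Section OperatorMatrix.
Variables (R : realType) (H : hilbertType R).

Definition opmx n (S : 'I_n -> 'I_n -> {linear H -> H}) (x : dsum H n) :
  dsum H n := [ffun i => \sum_j S i j (x j)].

Let opmx_linear n (S : 'I_n -> 'I_n -> {linear H -> H}) : linear (opmx S).
Proof.
move=> a x y; apply/ffunP => i; rewrite !ffunE scaler_sumr -big_split/=.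
by apply: eq_bigr => j _; rewrite !ffunE linearP.
Qed.

HB.instance Definition _ n (S : 'I_n -> 'I_n -> {linear H -> H}) :=
  GRing.isLinear.Build R[i] (dsum H n) (dsum H n) _ (opmx S) (opmx_linear S).

Lemma opmx_bounded n (S : 'I_n -> 'I_n -> {linear H -> H}) :
  (forall i j, bounded_op (S i j)) -> bounded_op (opmx S).
Proof.
move=> bS; have /choice[M MP] i : exists M : 'I_n -> R[i],
    forall j x, `|S i j x| <= M j * `|x|.
  by have /choice[M MP] := bS i; exists M.
exists (\sum_i \sum_j `|M i j|) => x.
apply: (le_trans (dsum_norm_le _)); rewrite mulr_suml; apply: ler_sum => i _.
rewrite ffunE (le_trans (ler_norm_sum _ _ _))// mulr_suml.
apply: ler_sum => j _.
have MR : M i j * `|x j| <= `|M i j| * `|x j|.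
  have := le_trans (normr_ge0 _) (MP i j (x j)).
  by move=> /ger0_norm <-; rewrite normrM normr_id.
apply: (le_trans (MP i j _)); apply: (le_trans MR).
by rewrite ler_wpM2l// dsum_norm_ge.
Qed.

Definition tridiag n (L D U : {linear H -> H}) (i j : 'I_n) : {linear H -> H} :=
  if i == j then D
  else if j == i.+1 :> nat then U
  else if i == j.+1 :> nat then L
  else \0.

End OperatorMatrix.

Definition expi (R : realType) (t : R) : R[i] := cos t +i* sin t.

Definition root_of_i (R : realType) (n : nat) : R[i] := expi (pi / (2 * n)%:R).

Lemma expiD (R : realType) (a b : R) : expi (a + b) = expi a * expi b.
Proof.
by rewrite /expi cosD sinD; apply/eqP; rewrite eq_complex /= eqxx /= addrC.
Qed.

Lemma root_of_iX (R : realType) n : (0 < n)%N -> root_of_i R n ^+ n = 0 +i* 1.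
Proof.
move=> n0; have E k : root_of_i R n ^+ k = expi (pi / (2 * n)%:R *+ k).
  elim: k => [|k IH]; first by rewrite expr0 mulr0n /expi cos0 sin0.
  by rewrite exprS IH mulrS expiD.
rewrite E -mulr_natr natrM invfM -!mulrA mulVf ?pnatr_eq0 -?lt0n// mulr1 /expi.
by rewrite cos_pihalf sin_pihalf.
Qed.

(* The exponent [n - 2] is taken in [int], as it is negative for [n = 1]. *)
Definition toeplitz_op (R : realType) (H : hilbertType R) (n : nat)
    (T S : {linear H -> H}) : {linear dsum H n -> dsum H n} :=
  opmx (tridiag ((0 +i* 1) \*: S) T (root_of_i R n ^ (n%:Z - 2) \*: S)).

Lemma toeplitz_op_bounded (R : realType) (H : hilbertType R) (n : nat)
    (T S : {linear H -> H}) :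
  bounded_op T -> bounded_op S -> bounded_op (toeplitz_op n T S).
Proof.
move=> bT bS; have bZ (a : R[i]) : bounded_op (a \*: S).
  have [M MP] := bS; exists (`|a| * M) => x.
  by rewrite /= normrZ -mulrA ler_wpM2l.
apply: opmx_bounded => i j; rewrite /tridiag.
case: ifP => // _; case: ifP => // _; case: ifP => // _.
by exists 0 => x; rewrite /= normr0 mul0r.
Qed.

(* Main.v *)
Require Import Defs.
From HB Require Import structures.
From mathcomp Require Import all_boot all_order all_algebra.
From mathcomp Require Import ring.
From mathcomp Require Import sesquilinear complex.
From mathcomp Require Import boolp classical_sets functions reals.
From mathcomp Require Import topology normedtype sequences trigo.

Set Implicit Arguments.
Unset Strict Implicit.
Unset Printing Implicit Defensive.

Import Order.TTheory GRing.Theory Num.Theory Num.Def.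
Import numFieldNormedType.Exports.

Local Open Scope classical_set_scope.
Local Open Scope ring_scope.
Local Open Scope complex_scope.

(** Conjugating by the diagonal unitary with entries [alpha ^ j] turns both
    off-diagonal entries of the matrix into [alpha ^ (n - 1) S], because
    [i = alpha ^ n]. What remains is [T] on the diagonal plus
    [alpha ^ (n - 1) S] placed on the adjacency matrix of the path with [n]
    vertices. That matrix is real symmetric with the [n] distinct eigenvalues
    [2 cos (k pi / (n + 1))] and sine eigenvectors, so an orthogonal change of
    basis makes the operator the orthogonal direct sum of the operators
    [A k = T + 2 alpha ^ (n - 1) cos (k pi / (n + 1)) S]
    ([toeplitz_op_block_diagonal]).

    The lower bound then holds because each summand embeds isometrically in
    the direct sum ([q_numradius_isometry]).

    The upper bound goes through the quadratic form. A unit vector [y] with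
    [<x, y> = q] is [q x + z] with [z] orthogonal to [x] and of norm
    [sqrt (1 - q ^ 2)]. Averaging over [z] and [- z] gives
    [q |<A x, x>| <= w_q(A) |x| ^ 2] ([quadratic_form_le]). Conversely, if
    [|<A x, x>| <= m |x| ^ 2] for all [x], then [|<A x, z>| <= 2 m |x| |z|] by
    polarization, hence [w_q(A) <= (q + 2 sqrt (1 - q ^ 2)) m]
    ([q_numradius_le]). A bound on quadratic forms passes from the summands to
    an orthogonal direct sum ([orthogonal_sum_quadratic_form_le]), so the
    converse applies to the whole matrix with [m = M / q], where [M] is the
    largest of the radii of the [A k].

    Spaces of dimension one call for separate care: no [z] exists, and for
    [q < 1] the radius is given by a convention. There an operator is a
    scalar [c], its radius is [q |c|], and all the inequalities persist. *)

(** * Inner products *)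

Section Inner.
Variables (R : realType) (K : hilbertType R).
Implicit Types (A : {linear K -> K}) (x y z : K) (a : R[i]).

Lemma innerC x y : '[x, y] = conjC '[y, x].
Proof. by rewrite hermC expr0 mul1r. Qed.

Lemma innerZl a x y : '[a *: x, y] = a * '[x, y].
Proof. by rewrite linearZl_LR. Qed.

Lemma innerZr a x y : '[x, a *: y] = conjC a * '[x, y].
Proof. by rewrite linearZr_LR. Qed.

Lemma conjC_real (t : R) : conjC t%:C = t%:C.
Proof. exact: conjc_real. Qed.

Lemma inner_CauchySchwarz x y : `|'[x, y]| <= `|x| * `|y|.
Proof.
by have := dot_CauchySchwarz (@inner R K) x y; rewrite -!norm_inner !sqrCK.
Qed.

(** Some vector lies outside the line of [x]; its component orthogonal to [x]
    is then nonzero and can be normalized. *)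
Lemma exists_unit_normal x : ~ one_dim K -> x != 0 ->
  exists z : K, `|z| = 1 /\ '[x, z] = 0.
Proof.
move=> nK x0.
have [y yx] : exists y, forall c : R[i], y <> c *: x.
  apply: contrapT => /forallNP h; apply: nK; exists x => // y.
  by have /existsNP[c /contrapT yc] := h y; exists c.
pose z := y - ('[y, x] / '[x, x]) *: x.
have z0 : z != 0.
  by apply/eqP => /eqP; rewrite subr_eq0 => /eqP; exact: yx.
have zx : '[z, x] = 0.
  rewrite linearBl/= innerZl divfK ?subrr//.
  by rewrite -norm_inner expf_neq0// normr_eq0.
exists (`|z|^-1 *: z); split.
  by rewrite normrZ normfV normr_id mulVf ?normr_eq0.
by rewrite innerZr innerC zx conjC0 mulr0.
Qed.

Lemma inner_polarization A x y :
  4 * '[A x, y] = '[A (x + y), x + y] - '[A (x - y), x - y]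
    + 'i * '[A (x + 'i *: y), x + 'i *: y]
    - 'i * '[A (x - 'i *: y), x - 'i *: y].
Proof.
have ii : 'i * 'i = -1 :> R[i] by rewrite -expr2 sqrCi.
have AZ a u : A (a *: u) = a *: A u by rewrite linearZ.
have AD u v : A (u + v) = A u + A v by rewrite linearD.
have AN u : A (- u) = - A u by rewrite linearN.
rewrite !(AD, AN, AZ).
rewrite !(linearNl, linearDl, linearNr, linearDr)/= !innerZl !innerZr conjCi.
ring: ii.
Qed.

Lemma inner_parallelogram x y :
  `|x + y| ^+ 2 + `|x - y| ^+ 2 = 2 * (`|x| ^+ 2 + `|y| ^+ 2).
Proof.
by rewrite !norm_inner !(linearBl, linearDl, linearBr, linearDr)/=; ring.
Qed.

(** For unit vectors, polarization writes [4 <A x, y>] as a combination with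
    unimodular coefficients of the quadratic form at the four vectors
    [x + i ^ k y]; their squared norms add up to 8 by the parallelogram law. *)
Lemma polarization_bound A (m : R[i]) :
  (forall x, `|'[A x, x]| <= m * `|x| ^+ 2) ->
  forall x y, `|'[A x, y]| <= 2 * m * (`|x| * `|y|).
Proof.
move=> Am x y.
have [->|x0] := eqVneq x 0.
  by rewrite linear0 linear0l !normr0 mul0r mulr0.
have [->|y0] := eqVneq y 0; first by rewrite linear0r !normr0 !mulr0.
have nx0 : 0 < `|x| by rewrite normr_gt0.
have ny0 : 0 < `|y| by rewrite normr_gt0.
wlog [x1 y1] : x y x0 y0 nx0 ny0 / `|x| = 1 /\ `|y| = 1 => [hw|].
  have nZ (z : K) : z != 0 -> `|(`|z|^-1 *: z)| = 1.
    by move=> z0; rewrite normrZ normfV normr_id mulVf ?normr_eq0.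
  have := hw (`|x|^-1 *: x) (`|y|^-1 *: y).
  rewrite !scaler_eq0 !invr_eq0 !normr_eq0 (negPf x0) (negPf y0) !nZ// ltr01.
  move=> /(_ isT isT isT isT (conj erefl erefl)).
  rewrite [A _]linearZ/= innerZl innerZr !normrM norm_conjC.
  rewrite !normfV !normr_id !mulr1.
  by rewrite mulrA -invfM mulrC ler_pdivrMr ?mulr_gt0.
rewrite x1 y1 !mulr1.
have i1 : `|'i : R[i]| = 1 by rewrite normCi.
have n4 : 0 < 4 :> R[i] by rewrite ltr0n.
rewrite -(ler_pM2l n4) -[X in X * _](gtr0_norm n4) -normrM inner_polarization.
apply: (le_trans (ler_normB _ _)).
apply: (le_trans (lerD (le_trans (ler_normD _ _)
  (lerD (ler_normB _ _) (lexx _))) (lexx _))).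
rewrite !normrM i1 !mul1r.
apply: (le_trans (lerD (lerD (lerD (Am _) (Am _)) (Am _)) (Am _))).
rewrite -addrA -!mulrDr !inner_parallelogram normrZ i1 x1 y1 le_eqVlt.
by apply/orP; left; apply/eqP; ring.
Qed.

End Inner.

(** * The q-numerical radius and the quadratic form *)

Section Radius.
Variables (R : realType) (K : hilbertType R).
Implicit Types (A B : {linear K -> K}) (x y : K) (a : R[i]) (q : R).

Lemma bounded_op_addZ A B a :
  bounded_op A -> bounded_op B -> bounded_op (A \+ a \*: B).
Proof.
move=> [M AM] [N BN]; exists (M + `|a| * N) => x.
rewrite mulrDl; apply: (le_trans (ler_normD _ _)); apply: lerD => //.
by rewrite /= normrZ -[leRHS]mulrA ler_wpM2l.
Qed.

Lemma q_numrange_bounded q A : bounded_op A ->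
  has_ubound [set Normc.normc z | z in q_numrange q%:C A].
Proof.
move=> [M AM]; exists (Normc.normc M) => _ [_ [x [y [x1 y1 _ ->]] <-]].
rewrite -lecR; change (`|'[A x, y]| <= `|M|).
apply: (le_trans (inner_CauchySchwarz _ _)); rewrite y1 mulr1.
have AxM : `|A x| <= M by have := AM x; rewrite x1 mulr1.
by rewrite (ger0_norm (le_trans _ AxM)).
Qed.

Lemma q_numradius_one_dim q A : one_dim K -> 0 < q < 1 ->
  exists2 c : R[i], forall x, A x = c *: x &
    (q_numradius q%:C A)%:C = q%:C * `|c|.
Proof.
move=> K1 q01; have [e e0 Ke] := K1.
have [c Ae] := Ke (A e).
have Ac x : A x = c *: x.
  by have [d ->] := Ke x; rewrite linearZ/= Ae !scalerA mulrC.
exists c => //.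
rewrite /q_numradius asboolT//= !ltcR q01.
rewrite (@xget_unique _ _ _ c)//; last first.
  move=> d dA; apply/eqP; rewrite -subr_eq0.
  have /eqP : (d - c) *: e = 0 by rewrite scalerBl -Ae dA subrr.
  by rewrite scaler_eq0 (negPf e0) orbF.
rewrite rmorphM/=; congr (_ * _); case/andP: q01 => q0 _.
by rewrite expr0n/= addr0 sqrtr_sqr gtr0_norm.
Qed.

Lemma q_numradiusE q A : ~ (one_dim K /\ 0 < q < 1) ->
  q_numradius q%:C A = sup [set Normc.normc z | z in q_numrange q%:C A].
Proof.
move=> h; rewrite /q_numradius; case: ifPn => // /andP[/asboolP K1].
by rewrite !ltcR => q01; case: h.
Qed.

(** In dimension one with [q < 1] the range is empty: equality in
    Cauchy-Schwarz would force [q = 1]. *)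
Lemma q_numrange_le q A z : bounded_op A -> 0 < q <= 1 ->
  q_numrange q%:C A z -> `|z| <= (q_numradius q%:C A)%:C.
Proof.
move=> bA q01 Wz.
have [[K1 qlt]|h] := pselect (one_dim K /\ 0 < q < 1); last first.
  rewrite q_numradiusE// lecR; apply: ub_le_sup; last by exists z.
  exact: q_numrange_bounded.
have [e e0 Ke] := K1; have [x [y [x1 y1 xy _]]] := Wz.
have [c ec] := Ke x; have [d yd] := Ke y.
have : `|'[x, y]| = `|x| * `|y|.
  rewrite ec yd innerZl innerZr -norm_inner !normrZ.
  by rewrite norm_conjC !normr_id mulrACA mulrA.
rewrite xy x1 y1 mulr1 => /eqP.
case/andP: qlt => q0 q1.
have qC : `|q%:C| = q%:C :> R[i] by rewrite ger0_norm ?lecR ?ltW.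
by rewrite qC => /eqP[] q1E; rewrite q1E ltxx in q1.
Qed.

Lemma q_numradius_ge0 q A : 0 <= q_numradius q%:C A.
Proof.
have nc z : 0 <= Normc.normc z :> R by case: z => a b; rewrite sqrtr_ge0.
rewrite /q_numradius; case: ifP => _; first by rewrite mulr_ge0.
set E := (X in sup X).
have [[[w [z Wz zw]] ubE]|nE] := pselect (has_sup E).
  by apply: (le_trans (nc z)); rewrite zw; apply: ub_le_sup => //; exists z.
by rewrite sup_out.
Qed.

(** For [x] a unit vector and [z] a unit normal to it, both
    [q <A x, x> + s <A x, z>] and [q <A x, x> - s <A x, z>] lie in the range
    when [s ^ 2 = 1 - q ^ 2]; their mean is [q <A x, x>]. In dimension one the
    bound is an equality. *)
Lemma quadratic_form_le q A x : bounded_op A -> 0 < q <= 1 ->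
  q%:C * `|'[A x, x]| <= (q_numradius q%:C A)%:C * `|x| ^+ 2.
Proof.
move=> bA q01; wlog x1 : x / `|x| = 1 => [hw|].
  have [->|x0] := eqVneq x 0.
    rewrite linear0r normr0 mulr0.
    by rewrite mulr_ge0 ?exprn_ge0 ?lecR ?q_numradius_ge0.
  have nx0 : `|x| != 0 by rewrite normr_eq0.
  have := hw (`|x|^-1 *: x).
  rewrite normrZ normfV normr_id mulVf// => /(_ erefl).
  rewrite [A _]linearZ/= innerZl innerZr !normrM norm_conjC !normfV !normr_id.
  rewrite expr1n mulr1 [X in _ * X]mulrA -invfM -expr2 mulrCA mulrC.
  by rewrite ler_pdivrMr ?exprn_gt0 ?normr_gt0.
rewrite x1 expr1n mulr1; case/andP: (q01) => q0 q1.
have [K1|K1] := pselect (one_dim K).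
  have [q1'|q1'] := eqVneq q 1.
    rewrite {1}q1' mul1r; apply: q_numrange_le => //.
    by exists x, x; rewrite -norm_inner x1 expr1n q1'.
  have q1'' : 0 < q < 1 by rewrite q0 lt_neqAle q1'.
  have [c Ac ->] := q_numradius_one_dim A K1 q1''.
  by rewrite Ac innerZl -norm_inner x1 expr1n mulr1.
have x0 : x != 0 by rewrite -normr_eq0 x1 oner_eq0.
have [z [z1 xz]] := exists_unit_normal K1 x0.
have zx : '[z, x] = 0 by rewrite innerC xz conjC0.
pose s := Num.sqrt (1 - q ^+ 2).
have bound t : t ^+ 2 = 1 - q ^+ 2 ->
    `|q%:C * '[A x, x] + t%:C * '[A x, z]| <= (q_numradius q%:C A)%:C.
  move=> t2; apply: q_numrange_le => //.
  exists x, (q%:C *: x + t%:C *: z); split=> //.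
  - apply/eqP; rewrite -(@eqrXn2 _ 2)// norm_inner expr1n.
    rewrite !linearDl/= !linearDr/= !innerZl !innerZr xz zx -!norm_inner x1 z1.
    rewrite !conjC_real !mulr0 !addr0 add0r expr1n !mulr1 -!rmorphM -rmorphD/=.
    by rewrite -!expr2 t2 addrC subrK.
  - rewrite linearDr/= !innerZr xz -norm_inner x1 expr1n conjC_real.
    by rewrite mulr0 addr0 mulr1.
  - by rewrite linearDr/= !innerZr !conjC_real.
have s2 : s ^+ 2 = 1 - q ^+ 2.
  by rewrite sqr_sqrtr// subr_ge0 expr_le1// ltW.
have Bs := bound s s2; have Bns := bound (- s) (etrans (sqrrN _) s2).
rewrite -[leLHS](mulrK (_ : 2 \is a GRing.unit)) ?unitfE ?pnatr_eq0//.
rewrite ler_pdivrMr ?ltr0n// [leRHS]mulr_natr mulr2n.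
apply: le_trans (lerD Bs Bns); apply: le_trans (ler_normD _ _).
have q0C : 0 <= q%:C by rewrite lecR ltW.
rewrite -{1}(ger0_norm q0C) -normrM.
rewrite -[X in _ * X](ger0_norm (ler0n R[i] 2)) -normrM.
by rewrite rmorphN/= mulNr addrACA subrr addr0 mulr_natr mulr2n.
Qed.

(** Only the component of [y] orthogonal to [x], of norm [sqrt (1 - q ^ 2)], is
    paid for at the price [2 m] that polarization gives. *)
Lemma q_numradius_le q A (m : R) : 0 < q <= 1 ->
  (forall x, `|'[A x, x]| <= m%:C * `|x| ^+ 2) -> 0 <= m ->
  q_numradius q%:C A <= (q + 2 * Num.sqrt (1 - q ^+ 2)) * m.
Proof.
move=> /andP[q0 q1] Am m0.
have r0 : 0 <= (q + 2 * Num.sqrt (1 - q ^+ 2)) * m.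
  by rewrite mulr_ge0// addr_ge0 ?(ltW q0)// mulr_ge0// sqrtr_ge0.
have q0C : 0 <= q%:C by rewrite lecR ltW.
have [[K1 qlt]|h] := pselect (one_dim K /\ 0 < q < 1).
  have [e e0 _] := K1.
  have [c Ac wc] := q_numradius_one_dim A K1 qlt.
  have : `|c| <= m%:C.
    have := Am e; rewrite Ac innerZl -norm_inner normrM normrX normr_id.
    by rewrite ler_pM2r// exprn_gt0 ?normr_gt0.
  rewrite -lecR wc => cm; apply: (@le_trans _ _ (q%:C * m%:C)).
    by rewrite ler_wpM2l.
  by rewrite -rmorphM lecR ler_wpM2r// lerDl mulr_ge0// sqrtr_ge0.
rewrite q_numradiusE//; set E := [set _ | _ in _].
have [->|/set0P E0] := eqVneq E set0; first by rewrite sup0.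
apply: ge_sup => // _ [_ [x [y [x1 y1 xy ->]]] <-].
rewrite -lecR; change (`|'[A x, y]|
  <= ((q + 2 * Num.sqrt (1 - q ^+ 2)) * m)%:C).
pose z := y - q%:C *: x.
have nz : `|z| = (Num.sqrt (1 - q ^+ 2))%:C.
  apply/eqP; rewrite -(@eqrXn2 _ 2)// ?lecR ?sqrtr_ge0//.
  rewrite -rmorphXn/= sqr_sqrtr ?subr_ge0 ?expr_le1 ?(ltW q0)//.
  rewrite norm_inner dnormB -!norm_inner y1 innerZr innerC xy conjC_real.
  rewrite normrZ x1 ger0_norm// expr1n mulr1 -!rmorphM/= conjC_real.
  rewrite -expr2 -rmorphXn rmorphB/= rmorph1; apply/eqP; ring.
have -> : y = q%:C *: x + z by rewrite addrC subrK.
rewrite linearDr/= innerZr conjC_real.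
apply: (le_trans (ler_normD _ _)).
rewrite rmorphM rmorphD mulrDl; apply: lerD.
  rewrite normrM ger0_norm// ler_wpM2l//.
  by have := Am x; rewrite x1 expr1n mulr1.
have := polarization_bound Am x z; rewrite x1 nz mul1r => /le_trans; apply.
by rewrite [in leRHS]rmorphM/= rmorph_nat mulrAC.
Qed.

End Radius.

(** * Intertwining by isometries *)

Section Intertwining.
Variables (R : realType) (H K : hilbertType R).

(** The map [V] carries the q-numerical range of [A] into that of [P]. When [H]
    is a line and [q < 1], so that the radius of [A] is conventional, the
    quadratic form of [P] on the image of [V] already reaches it, whatever the
    dimension of [K]. *)
Lemma q_numradius_isometry (V : {linear H -> K}) (A : {linear H -> H})
    (P : {linear K -> K}) (q : R) :
  bounded_op P -> 0 < q <= 1 ->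
  (forall x y, '[V x, V y] = '[x, y]) -> (forall x, P (V x) = V (A x)) ->
  q_numradius q%:C A <= q_numradius q%:C P.
Proof.
move=> bP q01 VV PV.
have nV x : `|V x| = `|x|.
  by apply/eqP; rewrite -(@eqrXn2 _ 2)// !norm_inner VV.
have [[H1 qlt]|h] := pselect (one_dim H /\ 0 < q < 1).
  have [e e0 _] := H1.
  have [c Ac wA] := q_numradius_one_dim A H1 qlt.
  have := quadratic_form_le (V e) bP q01.
  rewrite PV VV nV Ac innerZl -norm_inner normrM normrX normr_id mulrA.
  by rewrite ler_pM2r ?exprn_gt0 ?normr_gt0// -wA lecR.
rewrite q_numradiusE//; set E := [set _ | _ in _].
have [->|/set0P E0] := eqVneq E set0; first by rewrite sup0 q_numradius_ge0.
apply: ge_sup => // _ [z [x [y [x1 y1 xy zE]]] <-].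
rewrite -lecR; apply: q_numrange_le => //.
by exists (V x), (V y); rewrite !nV PV !VV.
Qed.

(** The hypotheses say that [K] is the orthogonal direct sum of copies of [H]
    and that [P] is block diagonal with blocks [A k]. Both [<P x, x>] and
    [|x| ^ 2] are then sums over the blocks, with no cross terms. *)
Lemma orthogonal_sum_quadratic_form_le (I : finType) (V : I -> {linear H -> K})
    (A : I -> {linear H -> H}) (P : {linear K -> K}) (m : R[i]) :
  (forall k l x y, '[V k x, V l y] = (k == l)%:R * '[x, y]) ->
  (forall x, exists h : I -> H, x = \sum_k V k (h k)) ->
  (forall k x, P (V k x) = V k (A k x)) ->
  (forall k x, `|'[A k x, x]| <= m * `|x| ^+ 2) ->
  forall x, `|'[P x, x]| <= m * `|x| ^+ 2.
Proof.
move=> VV Vdec PV Am x; have [h xh] := Vdec x.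
have sumV (f g : I -> H) :
    '[\sum_k V k (f k), \sum_k V k (g k)] = \sum_k '[f k, g k].
  rewrite linear_sumlz/=; apply: eq_bigr => k _.
  rewrite linear_sumr/= (bigD1 k)//= VV eqxx mul1r big1 ?addr0// => l lk.
  by rewrite VV eq_sym (negPf lk) mul0r.
have Px : P x = \sum_k V k (A k (h k)).
  by rewrite {1}xh linear_sum; apply: eq_bigr => k _; rewrite PV.
rewrite Px norm_inner xh !sumV mulr_sumr.
apply: (le_trans (ler_norm_sum _ _ _)); apply: ler_sum => k _.
by rewrite -norm_inner.
Qed.

End Intertwining.

(** * Diagonalization of the path graph *)

Section PathMatrix.
Variable R : realType.

Definition path_mx n : 'M[R]_n :=
  \matrix_(i, j) ((j == i.+1 :> nat)%:R + (i == j.+1 :> nat)%:R).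

Definition path_angle n (k : nat) : R := k%:R * pi / n.+1%:R.

(** Number the vertices from 1, so that index [j] stands for vertex [j + 1]. The
    two ends of the path then need no special treatment: their missing
    neighbours are vertices [0] and [n + 1], where [f] vanishes. *)
Lemma path_mx_mul n (f : nat -> R) (i : 'I_n) : f 0 = 0 -> f n.+1 = 0 ->
  \sum_(j < n) path_mx n i j * f j.+1 = f i.+2 + f i.
Proof.
move=> f0 fn; under eq_bigr do rewrite mxE mulrDl.
rewrite big_split/=; congr (_ + _).
  case: (ltnP i.+1 n) => iN.
    rewrite (bigD1 (Ordinal iN))//= eqxx mul1r big1 ?addr0// => j.
    by rewrite -val_eqE/= => /negPf ->; rewrite mul0r.
  have -> : i.+2 = n.+1 by congr _.+1; apply/eqP; rewrite eqn_leq iN ltn_ord.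
  rewrite fn big1// => j _; rewrite ltn_eqF ?mul0r//.
  exact: leq_trans (ltn_ord j) iN.
case: i => -[|i] /= iN; first by rewrite big1 ?f0// => j _; rewrite mul0r.
rewrite (bigD1 (Ordinal (ltnW iN)))//= eqxx mul1r big1 ?addr0// => j.
by rewrite -val_eqE/= eqSS eq_sym => /negPf ->; rewrite mul0r.
Qed.

Definition sine_mx n : 'M[R]_n :=
  \matrix_(j, k) sin (j.+1%:R * path_angle n k.+1).

Definition path_eigen n : 'rV[R]_n := \row_k (2 * cos (path_angle n k.+1)).

(** This is [sin (a + t) + sin (a - t) = 2 cos t sin a]; the angle is chosen so
    that [sin (j t)] vanishes at [j = n + 1] too. *)
Lemma path_sine_mx n :
  path_mx n *m sine_mx n = sine_mx n *m diag_mx (path_eigen n).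
Proof.
apply/matrixP => i k; rewrite mul_mx_diag !mxE.
pose t := path_angle n k.+1.
transitivity (\sum_(j < n) path_mx n i j * sin (j.+1%:R * t)).
  by apply: eq_bigr => j _; rewrite !mxE.
rewrite (path_mx_mul _ (f := fun j => sin (j%:R * t))) ?mul0r ?sin0//;
  last first.
  rewrite /t /path_angle mulrCA mulfV ?mulr1 ?pnatr_eq0//.
  rewrite mulr_natl -[_ *+ _]add0r.
  elim: k.+1 => [|m IH]; first by rewrite mulr0n addr0 sin0.
  by rewrite mulrSr addrA sinDpi IH oppr0.
rewrite -/t.
have -> : i.+2%:R * t = i.+1%:R * t + t.
  by rewrite -[i.+2]addn1 natrD mulrDl mul1r.
have -> : i%:R * t = i.+1%:R * t - t.
  by rewrite -[i.+1]addn1 natrD mulrDl mul1r addrK.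
rewrite sinD sinB; ring.
Qed.

Lemma path_angle_itv n (k : 'I_n) : 0 < path_angle n k.+1 < pi.
Proof.
have n0 : 0 < n.+1%:R :> R by rewrite ltr0n.
rewrite /path_angle divr_gt0 ?mulr_gt0 ?ltr0n ?pi_gt0//=.
by rewrite ltr_pdivrMr// mulrC ltr_pM2l ?pi_gt0// ltr_nat ltnS ltn_ord.
Qed.

Lemma path_eigen_inj n : injective (path_eigen n 0).
Proof.
have itv (k : 'I_n) : path_angle n k.+1 \in `[0, pi].
  by rewrite in_itv/=; have /andP[/ltW -> /ltW ->] := path_angle_itv k.
move=> j k; rewrite !mxE => /(mulfI (negbT (pnatr_eq0 R 2))).
move=> /(cos_inj (itv j) (itv k)).
move=> /(mulIf (invr_neq0 (negbT (pnatr_eq0 R n.+1)))).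
move=> /(mulIf (lt0r_neq0 (pi_gt0 R))) /eqP.
by rewrite eqr_nat => /eqP[] /val_inj.
Qed.

(** Eigenvectors of a symmetric matrix for distinct eigenvalues are
    orthogonal, so it is enough to normalize the sine vectors, and their
    norms do not have to be computed. *)
Lemma path_mx_diag n : exists U : 'M[R]_n,
  U^T *m U = 1%:M /\ path_mx n *m U = U *m diag_mx (path_eigen n).
Proof.
set J := path_mx n; set G := sine_mx n; set D := diag_mx _.
have JG : J *m G = G *m D := path_sine_mx n.
have JT : J^T = J by apply/matrixP => i j; rewrite !mxE addrC.
have DT : D^T = D := tr_diag_mx _.
have off j k : j != k -> (G^T *m G) j k = 0.
  move=> jk; have : (D *m (G^T *m G)) j k = ((G^T *m G) *m D) j k.
    by rewrite -[in LHS]DT mulmxA -trmx_mul -JG trmx_mul JT -!mulmxA JG.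
  rewrite mul_mx_diag mul_diag_mx mxE [RHS]mxE mulrC => /eqP.
  rewrite -subr_eq0 -mulrBr mulf_eq0 => /orP[/eqP//|].
  by rewrite subr_eq0 (inj_eq (@path_eigen_inj n)) (negPf jk).
pose s k := (G^T *m G) k k.
have s_gt0 k : 0 < s k.
  have n0 : (0 < n)%N := leq_ltn_trans (leq0n k) (ltn_ord k).
  rewrite /s mxE (bigD1 (Ordinal n0))//= ltr_pwDl ?sumr_ge0// => [|j _].
    rewrite !mxE /= mul1r -expr2 exprn_gt0// sin_gt0_pi//.
    exact: path_angle_itv.
  by rewrite mxE -expr2 sqr_ge0.
pose c : 'rV[R]_n := \row_k (Num.sqrt (s k))^-1.
exists (G *m diag_mx c); split; last first.
  by rewrite mulmxA JG -!mulmxA diag_mxC.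
rewrite trmx_mul tr_diag_mx -mulmxA (mulmxA G^T) mulmxA.
apply/matrixP => j k; rewrite mul_mx_diag mul_diag_mx !mxE.
have -> : \sum_i G^T j i * G i k = (G^T *m G) j k by rewrite [RHS]mxE.
have [<-|jk] := eqVneq j k; last by rewrite off// mulr0 mul0r.
have s0 := s_gt0 j.
rewrite -/(s j) -{2}(sqr_sqrtr (ltW s0)).
by rewrite expr2 mulrA mulVf ?mul1r ?mulfV ?gt_eqF ?sqrtr_gt0.
Qed.
End PathMatrix.

(** * Block diagonalization of the operator matrix *)

Section BlockDiagonal.
Variables (R : realType) (H : hilbertType R).

Lemma opmx_tridiagE n (L D U : {linear H -> H}) (x : dsum H n) (i : 'I_n) :
  opmx (tridiag L D U) x i = D (x i) +
    \sum_(j < n) ((j == i.+1 :> nat)%:R *: U (x j)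
      + (i == j.+1 :> nat)%:R *: L (x j)).
Proof.
rewrite ffunE (bigD1 i)//= [in RHS](bigD1 i)//= /tridiag eqxx.
have ii : (i == i.+1 :> nat) = false by rewrite ltn_eqF.
rewrite ii !scale0r add0r add0r; congr (_ + _); apply: eq_bigr => j ji.
rewrite eq_sym (negPf ji); case: eqP => [->|_].
  by rewrite scale1r ltn_eqF ?scale0r ?addr0// ltnS.
by case: eqP => _; rewrite !(scale1r, scale0r, add0r).
Qed.

(** The elementary tensor of [u] and [x], once the direct sum is seen as the
    tensor product of [C^n] with [H]. *)
Definition tensor_col n (u : 'cV[R[i]]_n) (x : H) : dsum H n :=
  [ffun j => u j 0 *: x].

Fact tensor_col_linear n (u : 'cV[R[i]]_n) : linear (tensor_col u).
Proof.
move=> a x y; apply/ffunP => i.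
by rewrite !ffunE scalerDr !scalerA mulrC.
Qed.

HB.instance Definition _ n (u : 'cV[R[i]]_n) :=
  GRing.isLinear.Build R[i] H (dsum H n) _ (tensor_col u) (tensor_col_linear u).

Lemma inner_tensor_col n (u v : 'cV[R[i]]_n) x y :
  '[tensor_col u x, tensor_col v y] = (\sum_j u j 0 * conjC (v j 0)) * '[x, y].
Proof.
rewrite dsum_innerE mulr_suml; apply: eq_bigr => j _.
by rewrite !ffunE innerZl innerZr mulrA.
Qed.

Lemma conjC_mul_root_of_i n : root_of_i R n * conjC (root_of_i R n) = 1.
Proof.
by rewrite -normCK /root_of_i normc_def/= cos2Dsin2 sqrtr1 expr1n.
Qed.

(** The powers of [alpha] in [v] absorb the asymmetry between the two
    off-diagonal entries: row [i] receives [alpha ^ (n - 2) alpha ^ (i + 1)]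
    from the entry above the diagonal and [alpha ^ n alpha ^ (i - 1)] from the
    one below, both equal to [alpha ^ (n - 1) alpha ^ i]. *)
Lemma toeplitz_op_tensor_col n (T S : {linear H -> H}) (u : 'cV[R]_n) (t : R)
    x :
  let alpha := root_of_i R n in
  let v := \col_j (alpha ^+ j * (u j 0)%:C) in
  path_mx R n *m u = t *: u ->
  toeplitz_op n T S (tensor_col v x) =
  tensor_col v ((T \+ (alpha ^+ n.-1 * t%:C) \*: S) x).
Proof.
move=> alpha v uE; apply/ffunP => i; rewrite opmx_tridiagE !ffunE.
have alpha0 : alpha != 0.
  apply/eqP => a0; have /eqP := conjC_mul_root_of_i n.
  by rewrite -/alpha a0 mul0r eq_sym oner_eq0.
have n0 : (0 < n)%N := leq_ltn_trans (leq0n i) (ltn_ord i).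
have an : alpha ^ (n%:Z - 2) * alpha = alpha ^+ n.-1.
  rewrite -{2}[alpha]expr1z -expfzDr// [RHS]exprnP; congr (_ ^ _).
  by rewrite -[in LHS](prednK n0) -addn1 PoszD; ring.
have nn : alpha ^+ n = alpha ^+ n.-1 * alpha by rewrite -exprSr prednK.
rewrite [T _]linearZ/= scalerDr; congr (_ + _).
transitivity (\sum_j
    (alpha ^+ n.-1 * alpha ^+ i * (path_mx R n i j * u j 0)%:C) *: S x).
  apply: eq_bigr => j _; rewrite ffunE/= !linearZ/= !scalerA -scalerDl.
  congr (_ *: _).
  rewrite !mxE !rmorphM rmorphD/= !rmorph_nat.
  have -> : 0 +i* 1 = alpha ^+ n :> R[i] by rewrite root_of_iX.
  case: eqP => [ji|_].
    rewrite ji ltn_eqF// -an exprS /= -/alpha; ring.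
  case: eqP => [ij|_]; last by rewrite !(mul0r, mulr0, addr0).
  rewrite ij nn exprS /=; ring.
rewrite -scaler_suml -mulr_sumr -rmorph_sum/=.
have -> : \sum_j path_mx R n i j * u j 0 = t * u i 0.
  by have /matrixP/(_ i 0) := uE; rewrite !mxE.
rewrite scalerA /v mxE; congr (_ *: _); rewrite rmorphM; ring.
Qed.

(** The isometry [V k] sends [x] to the tensor of [x] with the [k]-th
    eigenvector of the path, twisted by the powers of [alpha]. These vectors
    form an orthonormal basis of [C^n] since an orthogonal matrix has
    orthonormal rows as well as columns. *)
Lemma toeplitz_op_block_diagonal n (T S : {linear H -> H}) :
  let alpha := root_of_i R n in
  let A (k : nat) : {linear H -> H} :=
    T \+ (2 * alpha ^+ n.-1 * (cos (k%:R * pi / n.+1%:R))%:C) \*: S in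
  exists V : 'I_n -> {linear H -> dsum H n},
  [/\ forall k l x y, '[V k x, V l y] = (k == l)%:R * '[x, y],
      forall x, exists h : 'I_n -> H, x = \sum_k V k (h k) &
      forall k x, toeplitz_op n T S (V k x) = V k (A k.+1 x)].
Proof.
move=> alpha A.
have [U [UU JU]] := path_mx_diag R n.
pose v (k : 'I_n) : 'cV[R[i]]_n := \col_j (alpha ^+ j * (U j k)%:C).
pose V (k : 'I_n) : {linear H -> dsum H n} := tensor_col (v k).
have VV k l x y : '[V k x, V l y] = (k == l)%:R * '[x, y].
  rewrite inner_tensor_col; congr (_ * _).
  transitivity ((U^T *m U) k l)%:C.
    rewrite mxE rmorph_sum; apply: eq_bigr => j _.
    rewrite !mxE rmorphM rmorphXn/= conjC_real mulrACA -exprMn.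
    by rewrite conjC_mul_root_of_i expr1n mul1r -rmorphM.
  by rewrite UU mxE rmorph_nat.
have PV k x : toeplitz_op n T S (V k x) = V k (A k.+1 x).
  have vE : v k = \col_j (alpha ^+ j * (col k U j 0)%:C).
    by apply/matrixP => i j; rewrite !mxE.
  rewrite /V vE (toeplitz_op_tensor_col T S (t := path_eigen R n 0 k)).
    congr (tensor_col _ (_ + _ *: _)).
    by rewrite mxE rmorphM rmorph_nat mulrCA mulrA.
  by rewrite colE mulmxA JU -!colE; apply/matrixP => i j;
    rewrite mul_mx_diag !mxE mulrC.
have Vdec x : exists h : 'I_n -> H, x = \sum_k V k (h k).
  have vv j l : \sum_k v k j 0 * conjC (v k l 0) = (j == l)%:R.
    transitivity (alpha ^+ j * conjC alpha ^+ l * ((U *m U^T) j l)%:C).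
      rewrite mxE rmorph_sum mulr_sumr; apply: eq_bigr => k _.
      rewrite !mxE rmorphM rmorphXn/= conjC_real mulrACA.
      by rewrite -rmorphM.
    rewrite (mulmx1C UU) mxE rmorph_nat.
    case: eqP => [->|_]; last by rewrite mulr0.
    by rewrite -exprMn conjC_mul_root_of_i expr1n mul1r.
  exists (fun k => \sum_l conjC (v k l 0) *: x l); apply/ffunP => j.
  rewrite sum_ffunE.
  transitivity (\sum_k \sum_l (v k j 0 * conjC (v k l 0)) *: x l); last first.
    apply: eq_bigr => k _; rewrite ffunE scaler_sumr.
    by apply: eq_bigr => l _; rewrite scalerA.
  rewrite exchange_big/=; under eq_bigr do rewrite -scaler_suml vv.
  rewrite (bigD1 j)//= eqxx scale1r big1 ?addr0// => l /negPf lj.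
  by rewrite eq_sym lj scale0r.
by exists V.
Qed.

End BlockDiagonal.

Theorem theorem3p2 (R : realType) (H : hilbertType R) (T S : {linear H -> H})
    (q : R) (n : nat) (bT : bounded_op T) (bS : bounded_op S)
    (hq : 0 < q <= 1) (hn : (0 < n)%N) :
  let alpha := root_of_i R n in
  let A (k : nat) : {linear H -> H} :=
    T \+ (2 * alpha ^+ n.-1 * (cos (k%:R * pi / n.+1%:R))%:C) \*: S in
  let M : R := \big[Num.max/0]_(1 <= k < n.+1) q_numradius q%:C (A k) in
  M <= q_numradius q%:C (toeplitz_op n T S)
    <= (q + 2 * Num.sqrt (1 - q ^+ 2)) / q * M.
Proof.
pose alpha := root_of_i R n.
pose A (k : nat) : {linear H -> H} :=
  T \+ (2 * alpha ^+ n.-1 * (cos (k%:R * pi / n.+1%:R))%:C) \*: S.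
pose M : R := \big[Num.max/0]_(1 <= k < n.+1) q_numradius q%:C (A k).
change (M <= q_numradius q%:C (toeplitz_op n T S)
    <= (q + 2 * Num.sqrt (1 - q ^+ 2)) / q * M).
have bP := toeplitz_op_bounded n bT bS.
have bA k : bounded_op (A k) by exact: bounded_op_addZ.
have [V [VV Vdec PV]] := toeplitz_op_block_diagonal n T S.
have wM (k : 'I_n) : q_numradius q%:C (A k.+1) <= M.
  rewrite /M big_add1/= big_mkord.
  exact: (le_bigmax 0 (fun k : 'I_n => q_numradius q%:C (A k.+1))).
have M0 : 0 <= M.
  by rewrite /M; apply: bigmax_ge_id.
have q0 : 0 < q by case/andP: hq.
apply/andP; split.
  rewrite /M big_add1/= big_mkord; apply: bigmax_le => [|k _].
    exact: q_numradius_ge0.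
  apply: (q_numradius_isometry bP hq _ (PV k)) => x y.
  by rewrite VV eqxx mul1r.
rewrite mulrAC -mulrA.
apply: q_numradius_le => //; last by rewrite divr_ge0// ltW.
apply: (orthogonal_sum_quadratic_form_le VV Vdec PV) => k x.
rewrite rmorphM fmorphV [leRHS]mulrAC ler_pdivlMr ?ltcR// mulrC.
apply: (le_trans (quadratic_form_le x (bA _) hq)).
by rewrite ler_wpM2r ?exprn_ge0// lecR.
Qed.
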